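(* For every monoid $H$, regarded as a set pointed by its identity element $1_H$, there is a natural bijection of monoids (i.e. a bijective monoid homomorphism, natural in $H$) $$\theta_{\mathrm{fin},H}:\ \mathrm{Hom}_{\mathbf{Kl}(\mathscr P_{\mathrm{fin}})}(\mathbb Z/2\mathbb Z,H)\longrightarrow \mathcal P_{\mathrm{fin},1_H}(H).$$ Under this identification, convolution on the left-hand side is the usual product $A\star B=\{ab:a\in A,\ b\in B\}$ of reduced finite subsets.
   Context: $\mathbf{PSet}$ is the category of pointed sets and basepoint-preserving maps. The reduced finite powerset monad $\mathscr P_{\mathrm{fin}}=(\mathcal P_{\mathrm{fin},-},\eta,\mu)$ on $\mathbf{PSet}$ sends $(X,* )$ to $\mathcal P_{\mathrm{fin},*}(X,* )$, the set of finite subsets $A\subseteq X$ with $*\in A$, pointed by $\{*\}$; it acts on morphisms by direct image, and $\eta_{(X,* )}(x)=\{x,*\}$, $\mu_{(X,* )}(\mathcal A)=\bigcup_{A\in\mathcal A}A$. A morphism $X\rightsquigarrow Y$ in the Kleisli category $\mathbf{Kl}(\mathscr P_{\mathrm{fin}})$ is a morphism $X\to\mathcal P_{\mathrm{fin},-}(Y)$ in $\mathbf{PSet}$. For a monoid $H$, $\mathcal P_{\mathrm{fin},1_H}(H)=\{A\subseteq H: A\text{ finite},\ 1_H\in A\}$ is the reduced finitary power monoid, with multiplication $A\star B=\{ab:a\in A,b\in B\}$ and identity $\{1_H\}$. $\mathbb Z/2\mathbb Z$ denotes the two-element set $\{0,1\}$ with basepoint $0$. Thus an element $u$ of $\mathrm{Hom}_{\mathbf{Kl}(\mathscr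 P_{\mathrm{fin}})}(\mathbb Z/2\mathbb Z,H)$ is a map $u:\{0,1\}\to\mathcal P_{\mathrm{fin},1_H}(H)$ with $u(0)=\{1_H\}$. This Hom-space is a monoid under the convolution $(u\star v)(i):=u(i)\star v(i)$, $i\in\mathbb Z/2\mathbb Z$, with identity the map constantly equal to $\{1_H\}$. *)

(* Defs.v *)
From HB Require Import structures.
From mathcomp Require Import all_boot all_algebra finmap.
From mathcomp Require Import boolp classical_sets.

Set Implicit Arguments.
Unset Strict Implicit.
Unset Printing Implicit Defensive.

Local Open Scope fset_scope.

(* The objects of PSet are [pointedType]s and its morphisms are [phom]s. The choice structure that
   this interface carries exists on every type by [boolp.gen_choiceMixin]; the
   same holds for [monoidType]. *)

Record phom (X Y : pointedType) := PHom {
  phom_fun :> X -> Y;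
  phom_pointP : phom_fun point == point }.

HB.instance Definition _ X Y := [isSub for @phom_fun X Y].
HB.instance Definition _ X Y := [Choice of phom X Y by <:].

Lemma phom_point (X Y : pointedType) (f : phom X Y) : f point = point.
Proof. exact/eqP/phom_pointP. Qed.

Lemma phom_comp_subproof (X Y Z : pointedType) (g : phom Y Z) (f : phom X Y) :
  g (f point) == point.
Proof. by rewrite !phom_point. Qed.

Definition phom_comp (X Y Z : pointedType) (g : phom Y Z) (f : phom X Y) :
  phom X Z := @PHom X Z (fun x => g (f x)) (phom_comp_subproof g f).

Record pfin (X : pointedType) := PFin {
  pfin_set :> {fset X};
  pfin_pointP : point \in pfin_set }.

HB.instance Definition _ X := [isSub for @pfin_set X].
HB.instance Definition _ X := [Choice of pfin X by <:].
HB.instance Definition _ (X : pointedType) :=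
  isPointed.Build (pfin X) (PFin (fset11 (point : X))).

Section Monad.
Variables X Y : pointedType.

Lemma pfin_map_fun_subproof (f : phom X Y) (A : pfin X) :
  point \in [fset f x | x in pfin_set A].
Proof. by apply/imfsetP; exists point; rewrite ?phom_point ?pfin_pointP. Qed.

Definition pfin_map_fun (f : phom X Y) (A : pfin X) : pfin Y :=
  PFin (pfin_map_fun_subproof f A).

Lemma pfin_map_subproof (f : phom X Y) : pfin_map_fun f point == point.
Proof.
apply/eqP/val_inj/fsetP => y; rewrite /= inE; apply/imfsetP/eqP => [[x]|->].
  by rewrite inE => /eqP -> ->; rewrite phom_point.
by exists point; rewrite ?inE ?phom_point.
Qed.

Definition pfin_map (f : phom X Y) : phom (pfin X) (pfin Y) :=
  PHom (pfin_map_subproof f).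

Definition pfin_eta_fun (x : X) : pfin X := PFin (fset22 x point).

Lemma pfin_eta_subproof : pfin_eta_fun point == point.
Proof. by apply/eqP/val_inj/fsetP => y; rewrite !inE orbb. Qed.

Definition pfin_eta : phom X (pfin X) := PHom pfin_eta_subproof.

Lemma pfin_mu_fun_subproof (AA : pfin (pfin X)) :
  point \in \bigcup_(A <- pfin_set AA) pfin_set A.
Proof.
apply/bigfcupP; exists point; last exact: pfin_pointP.
by rewrite pfin_pointP.
Qed.

Definition pfin_mu_fun (AA : pfin (pfin X)) : pfin X :=
  PFin (pfin_mu_fun_subproof AA).

Lemma pfin_mu_subproof : pfin_mu_fun point == point.
Proof. by apply/eqP/val_inj; rewrite /= big_seq_fset1. Qed.

Definition pfin_mu : phom (pfin (pfin X)) (pfin X) := PHom pfin_mu_subproof.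

End Monad.

Definition kl_hom (X Y : pointedType) := phom X (pfin Y).
HB.instance Definition _ X Y := Choice.on (kl_hom X Y).

Definition kl_comp (X Y Z : pointedType) (v : kl_hom Y Z) (u : kl_hom X Y) :
  kl_hom X Z := phom_comp (pfin_mu Z) (phom_comp (pfin_map v) u).

(* The canonical functor PSet -> Kl, identity on objects. *)
Definition kl_pure (X Y : pointedType) (f : phom X Y) : kl_hom X Y :=
  phom_comp (pfin_eta Y) f.

HB.instance Definition _ n := isPointed.Build 'I_n.+1 ord0.

Definition pset_of (H : monoidType) : Type := H.
HB.instance Definition _ H := Monoid.on (pset_of H).
HB.instance Definition _ H := isPointed.Build (pset_of H) (1%g : H).

(* A monoid homomorphism is a [UMagmaMorphism] between monoids: it preserves
   both the product and the identity. *)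
Lemma pset_hom_subproof (H K : monoidType) (f : UMagmaMorphism.type H K) :
  (f : pset_of H -> pset_of K) point == point.
Proof. exact/eqP/gmulf1. Qed.

Definition pset_hom (H K : monoidType) (f : UMagmaMorphism.type H K) :
  phom (pset_of H) (pset_of K) := PHom (pset_hom_subproof f).

(* [pfin (pset_of H)] is also the carrier of the reduced finitary power monoid
   of [H]. *)
Section PowerMonoid.
Variable H : monoidType.
Local Notation P1 := (pfin (pset_of H)).
Implicit Types A B C : P1.

Lemma pfin_mul_subproof A B :
  (point : pset_of H) \in
    [fset (a * b)%g | a in pfin_set A, b in pfin_set B].
Proof.
apply/imfset2P; exists point; first exact: pfin_pointP.
by exists point; [exact: pfin_pointP | rewrite mulg1].
Qed.

Definition pfin_mul A B : P1 := PFin (pfin_mul_subproof A B).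

Lemma pfin_mulA : associative pfin_mul.
Proof.
move=> A B C; apply/val_inj/fsetP => x; apply/imfset2P/imfset2P.
  move=> [a aA [_ /imfset2P[b bB [c cC ->]] ->]].
  exists (a * b)%g; first by apply/imfset2P; exists a => //; exists b.
  by exists c; rewrite ?mulgA.
move=> [_ /imfset2P[a aA [b bB ->]] [c cC ->]].
exists a => //; exists (b * c)%g; last by rewrite mulgA.
by apply/imfset2P; exists b => //; exists c.
Qed.

Lemma pfin_mul1 : left_id (point : P1) pfin_mul.
Proof.
move=> A; apply/val_inj/fsetP => x; apply/imfset2P/idP => [[a]|xA].
  by rewrite inE => /eqP -> [b bA ->]; rewrite mul1g.
by exists point; rewrite ?inE //; exists x; rewrite ?mul1g.
Qed.

Lemma pfin_mulr1 : right_id (point : P1) pfin_mul.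
Proof.
move=> A; apply/val_inj/fsetP => x; apply/imfset2P/idP => [[a aA [b]]|xA].
  by rewrite inE => /eqP -> ->; rewrite mulg1.
by exists x => //; exists point; rewrite ?inE ?mulg1.
Qed.

HB.instance Definition _ := isMonoid.Build P1 pfin_mulA pfin_mul1 pfin_mulr1.

Variable X : pointedType.
Implicit Types u v w : kl_hom X (pset_of H).

Lemma kl_one_subproof : (fun=> 1%g : P1) (point : X) == point.
Proof. by []. Qed.

Definition kl_one : kl_hom X (pset_of H) := PHom kl_one_subproof.

Lemma kl_conv_subproof u v : (u point * v point)%g == point.
Proof. by rewrite !phom_point (mul1g (1%g : P1)). Qed.

Definition kl_conv u v : kl_hom X (pset_of H) :=
  @PHom X P1 (fun i => (u i * v i)%g) (kl_conv_subproof u v).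

Lemma kl_convA : associative kl_conv.
Proof. by move=> u v w; apply/val_inj/funext => i /=; rewrite mulgA. Qed.

Lemma kl_conv1 : left_id kl_one kl_conv.
Proof. by move=> u; apply/val_inj/funext => i /=; rewrite mul1g. Qed.

Lemma kl_convr1 : right_id kl_one kl_conv.
Proof. by move=> u; apply/val_inj/funext => i /=; rewrite mulg1. Qed.

HB.instance Definition _ := isMonoid.Build (kl_hom X (pset_of H))
  kl_convA kl_conv1 kl_convr1.

End PowerMonoid.

(* Main.v *)
(** A basepoint-preserving map out of [{0, 1}] is determined by its value at the
    non-basepoint [1], which is arbitrary; so [theta] is evaluation at [1]. *)

Require Import Defs.
From mathcomp Require Import all_boot all_algebra finmap.
From mathcomp Require Import boolp classical_sets.

(** Convolution is pointwise, so evaluation at 1 is multiplicative by definition. Naturality holds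
    for evaluation at any point: by [kl_comp_pureE], an instance of the monad unit law, composing
    with a pure map takes direct images. Bijectivity is [phom_from_Z2_bij]. *)

Lemma kl_comp_pureE (X Y Z : pointedType) (f : phom Y Z) (u : kl_hom X Y)
    (x : X) : kl_comp (kl_pure f) u x = pfin_map f (u x).
Proof.
apply/val_inj/fsetP => z /=; apply/bigfcupP/imfsetP => /=.
  move=> [A /andP[/imfsetP[/= y yu ->] _]].
  rewrite !inE => /orP[/eqP->|/eqP->]; first by exists y.
  (* The basepoint added by [pfin_eta] is already in the image, as [f point] with [point] in
     [u x]. *)
  by exists point; rewrite ?phom_point ?pfin_pointP.
move=> [y yu ->]; exists (pfin_eta Z (f y)); last by rewrite !inE eqxx.
by rewrite andbT; apply/imfsetP; exists y.
Qed.

Definition phom_from_Z2 (Y : pointedType) (y : Y) : phom 'Z_2 Y :=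
  @PHom 'Z_2 Y (fun i => if i == point then point else y) (eqxx _).

Lemma phom_from_Z2_bij (Y : pointedType) :
  bijective (fun u : phom 'Z_2 Y => u 1%R).
Proof.
exists (@phom_from_Z2 Y) => [u|y] //.
apply/val_inj/funext => i /=; case: eqP => [->|]; first by rewrite phom_point.
(* [nz] excludes 0; at 1 only the bound proofs differ. *)
by case: i => -[|[|//]] lti nz; [case: nz|congr (u _)]; apply/val_inj.
Qed.

Theorem theorem4 :
  exists theta : forall H : monoidType,
      kl_hom 'Z_2 (pset_of H) -> pfin (pset_of H),
    [/\ forall H : monoidType, bijective (theta H),
        forall H : monoidType, monoid_morphism (theta H),
        forall (H K : monoidType) (f : UMagmaMorphism.type H K)
            (u : kl_hom 'Z_2 (pset_of H)),
          theta K (kl_comp (kl_pure (pset_hom f)) u) =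
          pfin_map (pset_hom f) (theta H u)
      & forall (H : monoidType) (u v : kl_hom 'Z_2 (pset_of H)),
          pfin_set (theta H (u * v)%g) =
          [fset (a * b)%g | a in pfin_set (theta H u),
                            b in pfin_set (theta H v)]%fset].
Proof.
(* The morphism and product clauses hold by computation. *)
exists (fun H (u : kl_hom 'Z_2 (pset_of H)) => u 1%R); split => //.
- by move=> H; apply: phom_from_Z2_bij.
- by move=> H K f u; apply: kl_comp_pureE.
Qed.
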